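(* Let $H$ be a coquasi-bialgebra and $R$ an associative algebra, and let $(R,\cdot_1,\sigma_1)$ and $(R,\cdot_2,\sigma_2)$ be two $H$-crossed systems on $R$. For any algebra isomorphism $\theta:R\overline{\#}_{\sigma_1}H\to R\overline{\#}_{\sigma_2}H$ which is left $R$-linear and right $H$-colinear, there is a convolution invertible map $\mathfrak{a}:H\to R$ such that, for all $r\in R$ and $h,g\in H$: (1) $\theta(r\overline{\#}_{\sigma_1}h)=r\,\mathfrak{a}(h_1)\overline{\#}_{\sigma_2}h_2$; (2) $h\cdot_2 r=\mathfrak{a}^{-1}(h_1)(h_2\cdot_1 r)\mathfrak{a}(h_3)$; (3) $\sigma_2(h,g)=\mathfrak{a}^{-1}(h_1)[h_2\cdot_1\mathfrak{a}^{-1}(g_1)]\sigma_1(h_3,g_2)\mathfrak{a}(h_4g_3)$. Conversely, for each convolution invertible map $\mathfrak{a}:H\to R$ with properties (2) and (3), the map $\theta$ given by (1) is an isomorphism of $H$-comodule algebras which is left $R$-linear and right $H$-colinear.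
   Context: All vector spaces, algebras and tensor products are over a fixed field $\Bbbk$; Sweedler notation is used, $\Delta(h)=h_1\otimes h_2$. Coquasi-bialgebra: a coassociative counital coalgebra $(H,\Delta,\varepsilon)$ with coalgebra morphisms $m:H\otimes H\to H$ (written $h\otimes g\mapsto hg$) and $u:\Bbbk\to H$ (with $u(1)=1_H$), and a convolution invertible $\omega\in(H\otimes H\otimes H)^*$ such that for all $h,g,k,l\in H$: $h_1(g_1k_1)\omega(h_2,g_2,k_2)=\omega(h_1,g_1,k_1)(h_2g_2)k_2$; $1_Hh=h1_H=h$; $\omega(h_1,g_1,k_1l_1)\omega(h_2g_2,k_2,l_2)=\omega(g_1,k_1,l_1)\omega(h_1,g_2k_2,l_2)\omega(h_2,g_3,k_3)$; $\omega(h,1_H,g)=\varepsilon(h)\varepsilon(g)$. Right $H$-comodule algebra: a right $H$-comodule $(A,\rho_A)$, $\rho_A(a)=a_0\otimes a_1$, with an $H$-colinear multiplication and an $H$-colinear two-sided unit $1_A$, such that $(ab)c=a_0(b_0c_0)\,\omega(a_1,b_1,c_1)$ for all $a,b,c\in A$. $H$-crossed system $(R,\cdot,\sigma)$: an associative unital algebra $R$, a bilinear map $\cdot:H\otimes R\to R$ and a linear map $\sigma:H\otimes H\to R$ such that for all $h,g,l\in H$, $r,s\in R$: $h\cdot(rs)=(h_1\cdot r)(h_2\cdot s)$, $h\cdot 1_R=\varepsilon(h)1_R$, $1_H\cdot r=r$, $[h_1\cdot(g_1\cdot r)]\sigma(h_2,g_2)=\sigma(h_1,g_1)[(h_2g_2)\cdot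 r]$, $\sigma(h,1_H)=\sigma(1_H,h)=\varepsilon(h)1_R$, $[h_1\cdot\sigma(g_1,l_1)]\sigma(h_2,g_2l_2)=\sigma(h_1,g_1)\sigma(h_2g_2,l_1)\omega^{-1}(h_3,g_3,l_2)$. The crossed product $R\overline{\#}_{\sigma}H$ is $R\otimes H$ with multiplication $(r\overline{\#}_{\sigma}h)(s\overline{\#}_{\sigma}g)=r(h_1\cdot s)\sigma(h_2,g_1)\overline{\#}_{\sigma}h_3g_2$, unit $1_R\overline{\#}_{\sigma}1_H$ and coaction $I_R\otimes\Delta$ (it is a right $H$-comodule algebra); the left $R$-action is multiplication on the first factor. An algebra isomorphism preserves multiplication and unit. Convolution on $Hom(H,R)$ is $(\mathfrak{a}\mathfrak{b})(h)=\mathfrak{a}(h_1)\mathfrak{b}(h_2)$ with unit $\varepsilon 1_R$; $\mathfrak{a}^{-1}$ is the convolution inverse. *)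

(* Defs.v *)
From HB Require Import structures.
From mathcomp Require Import all_boot all_algebra.
From mathcomp Require Import boolp.

Set Implicit Arguments.
Unset Strict Implicit.
Unset Printing Implicit Defensive.

Import GRing.Theory.
Local Open Scope ring_scope.
Local Open Scope quotient_scope.

Section TensorRel.
Variables (k : fieldType) (V W : lmodType k).

(* The list [:: (v_1, w_1); ...; (v_n, w_n)] stands for the sum of the
   v_i ⊗ w_i; the quotient of lists by this congruence is V ⊗ W. *)
Inductive tensor_rel : seq (V * W) -> seq (V * W) -> Prop :=
| trel_refl s : tensor_rel s s
| trel_sym s t : tensor_rel s t -> tensor_rel t s
| trel_trans s t u : tensor_rel s t -> tensor_rel t u -> tensor_rel s u
| trel_cat s s' t t' :
    tensor_rel s s' -> tensor_rel t t' -> tensor_rel (s ++ t) (s' ++ t')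
| trel_catC s t : tensor_rel (s ++ t) (t ++ s)
| trel_0l w : tensor_rel [:: (0, w)] [::]
| trel_Dl v v' w : tensor_rel [:: (v + v', w)] [:: (v, w); (v', w)]
| trel_Dr v w w' : tensor_rel [:: (v, w + w')] [:: (v, w); (v, w')]
| trel_Z a v w : tensor_rel [:: (a *: v, w)] [:: (v, a *: w)].

Definition tensor_relb : rel (seq (V * W)) := fun s t => `[< tensor_rel s t >].

Lemma tensor_relb_refl : reflexive tensor_relb.
Proof. by move=> s; apply/asboolP; apply: trel_refl. Qed.

Lemma tensor_relb_sym : symmetric tensor_relb.
Proof. by move=> s t; apply/asboolP/asboolP; apply: trel_sym. Qed.

Lemma tensor_relb_trans : transitive tensor_relb.
Proof. by move=> t s u /asboolP st /asboolP tu; apply/asboolP/(trel_trans st). Qed.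

Canonical tensor_equiv :=
  EquivRel tensor_relb tensor_relb_refl tensor_relb_sym tensor_relb_trans.

Definition tensor := {eq_quot tensor_equiv}.

HB.instance Definition _ := Choice.on tensor.
HB.instance Definition _ := EqQuotient.on tensor.

Lemma tensor_piP s t : tensor_rel s t <-> \pi_tensor s = \pi_tensor t.
Proof.
split=> [st|/eqP]; first by apply/eqP; rewrite piE /=; apply/asboolP.
by rewrite piE => /asboolP.
Qed.

Lemma tensor_repr s : tensor_rel (repr (\pi_tensor s)) s.
Proof. by apply/tensor_piP; rewrite reprK. Qed.

Lemma tensor_pi (x : tensor) : exists s, x = \pi_tensor s.
Proof. by exists (repr x); rewrite reprK. Qed.

Definition pure (v : V) (w : W) : tensor := \pi_tensor [:: (v, w)].

Definition tensor_add (x y : tensor) : tensor := \pi_tensor (repr x ++ repr y).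
Definition tensor_zero : tensor := \pi_tensor [::].
Definition tensor_scale (a : k) (x : tensor) : tensor :=
  \pi_tensor [seq (a *: p.1, p.2) | p <- repr x].
Definition tensor_opp (x : tensor) : tensor := tensor_scale (-1) x.

Lemma trel_map a s t : tensor_rel s t ->
  tensor_rel [seq (a *: p.1, p.2) | p <- s] [seq (a *: p.1, p.2) | p <- t].
Proof.
elim=> {s t} /=.
- by move=> s; apply: trel_refl.
- by move=> s t _; apply: trel_sym.
- by move=> s t u _ st _; apply: trel_trans.
- by move=> s s' t t' _ ss' _ tt'; rewrite !map_cat; apply: trel_cat.
- by move=> s t; rewrite !map_cat; apply: trel_catC.
- by move=> w; rewrite scaler0; apply: trel_0l.
- by move=> v v' w; rewrite scalerDr; apply: trel_Dl.
- by move=> v w w'; apply: trel_Dr.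
- by move=> b v w; rewrite scalerA mulrC -scalerA; apply: trel_Z.
Qed.

Lemma tensor_addE s t : tensor_add (\pi_tensor s) (\pi_tensor t) = \pi_tensor (s ++ t).
Proof. by apply/tensor_piP; apply: trel_cat; apply: tensor_repr. Qed.

Lemma tensor_scaleE a s :
  tensor_scale a (\pi_tensor s) = \pi_tensor [seq (a *: p.1, p.2) | p <- s].
Proof. by apply/tensor_piP; apply/trel_map/tensor_repr. Qed.

Lemma tensor_addA : associative tensor_add.
Proof.
move=> x y z; have [s ->] := tensor_pi x; have [t ->] := tensor_pi y; have [u ->] := tensor_pi z.
by rewrite !tensor_addE catA.
Qed.

Lemma tensor_addC : commutative tensor_add.
Proof.
move=> x y; have [s ->] := tensor_pi x; have [t ->] := tensor_pi y.
by rewrite !tensor_addE; apply/tensor_piP/trel_catC.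
Qed.

Lemma tensor_add0 : left_id tensor_zero tensor_add.
Proof. by move=> x; have [s ->] := tensor_pi x; rewrite tensor_addE. Qed.

Lemma tensor_scaleDl a b x :
  tensor_scale (a + b) x = tensor_add (tensor_scale a x) (tensor_scale b x).
Proof.
have [s ->] := tensor_pi x; rewrite !tensor_scaleE tensor_addE; apply/tensor_piP.
elim: s => [|[v w] s IHs] /=; first exact: trel_refl.
rewrite -[X in tensor_rel X _]cat1s -[X in tensor_rel _ X]cat1s.
apply: (@trel_trans _ ([:: (a *: v, w); (b *: v, w)] ++
   ([seq (a *: p.1, p.2) | p <- s] ++ [seq (b *: p.1, p.2) | p <- s]))).
  by apply: trel_cat => //; rewrite scalerDl; apply: trel_Dl.
rewrite -cat1s -catA; apply: trel_cat; first exact: trel_refl.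
rewrite -[(b *: v, w) :: [seq _ | _ <- _]]cat1s !catA.
by apply: trel_cat; [apply: trel_catC | apply: trel_refl].
Qed.

Lemma tensor_scale0 x : tensor_scale 0 x = tensor_zero.
Proof.
have [s ->] := tensor_pi x; rewrite tensor_scaleE; apply/tensor_piP.
elim: s => [|[v w] s IHs] /=; first exact: trel_refl.
rewrite -cat1s -[X in tensor_rel _ X]cats0; apply: trel_cat => //.
by rewrite scale0r; apply: trel_0l.
Qed.

Lemma tensor_scale1 : left_id 1 tensor_scale.
Proof.
move=> x; have [s ->] := tensor_pi x; rewrite tensor_scaleE; congr (\pi_tensor _).
by rewrite -[RHS]map_id; apply: eq_map => -[v w]; rewrite scale1r.
Qed.

Lemma tensor_scaleA a b x :
  tensor_scale a (tensor_scale b x) = tensor_scale (a * b) x.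
Proof.
have [s ->] := tensor_pi x; rewrite !tensor_scaleE -map_comp; congr (\pi_tensor _).
by apply: eq_map => -[v w]; rewrite /= scalerA.
Qed.

Lemma tensor_scaleDr : right_distributive tensor_scale tensor_add.
Proof.
move=> a x y; have [s ->] := tensor_pi x; have [t ->] := tensor_pi y.
by rewrite tensor_addE !tensor_scaleE tensor_addE map_cat.
Qed.

Lemma tensor_addN : left_inverse tensor_zero tensor_opp tensor_add.
Proof.
move=> x; rewrite -{2}[x]tensor_scale1 -tensor_scaleDl.
by rewrite addNr tensor_scale0.
Qed.

HB.instance Definition _ := GRing.isZmodule.Build tensor
  tensor_addA tensor_addC tensor_add0 tensor_addN.
HB.instance Definition _ := GRing.Zmodule_isLmodule.Build k tensor
  tensor_scaleA tensor_scale1 tensor_scaleDr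
  (fun x a b => tensor_scaleDl a b x).

Lemma pureDl v v' w : pure (v + v') w = pure v w + pure v' w.
Proof. by rewrite [RHS]tensor_addE; apply/tensor_piP/trel_Dl. Qed.

Lemma pureDr v w w' : pure v (w + w') = pure v w + pure v w'.
Proof. by rewrite [RHS]tensor_addE; apply/tensor_piP/trel_Dr. Qed.

Lemma pureZl a v w : pure (a *: v) w = a *: pure v w.
Proof. by rewrite [RHS]tensor_scaleE. Qed.

Lemma pureZr a v w : pure v (a *: w) = a *: pure v w.
Proof. by rewrite -pureZl; apply/esym/tensor_piP/trel_Z. Qed.

Lemma tensor_sum (x : tensor) : x = \sum_(p <- repr x) pure p.1 p.2.
Proof.
rewrite -{1}[x]reprK; elim: (repr x) => [|[v w] s IHs]; first by rewrite big_nil.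
by rewrite big_cons -IHs /= [RHS]tensor_addE.
Qed.

(* For a bilinear f this is the linear map out of V ⊗ W that f induces: the
   value does not depend on the expression of x as a sum of pure tensors
   (tlift_pure and tlift_lin below). *)
Definition tlift (U : lmodType k) (f : V -> W -> U) (x : tensor) : U :=
  \sum_(p <- repr x) f p.1 p.2.

End TensorRel.

Arguments pure {k V W}.
Arguments tlift {k V W U}.

Notation "V ⊗ W" := (tensor V%type W%type) (at level 40, left associativity) : type_scope.
Notation "v ⊗ w" := (pure v w) (at level 40, left associativity) : ring_scope.

Notation "\ten_ ( x , y <- t ) E" := (tlift (fun x y => E) t)
  (at level 41, E at level 41, x binder, y binder, t at level 50,
   format "'[' \ten_ ( x ,  y  <-  t ) '/  '  E ']'") : ring_scope.

Section Lin.
Variable k : fieldType.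
Implicit Types U V W X : lmodType k.

Definition lin U V (f : U -> V) :=
  forall a x y, f (a *: x + y) = a *: f x + f y.

Lemma lin_D U V (f : U -> V) : lin f -> forall x y, f (x + y) = f x + f y.
Proof. by move=> lf x y; rewrite -[x]scale1r lf !scale1r. Qed.

Lemma lin_0 U V (f : U -> V) : lin f -> f 0 = 0.
Proof. by move=> lf; apply: (addIr (f 0)); rewrite -(lin_D lf) !add0r. Qed.

Lemma lin_Z U V (f : U -> V) : lin f -> forall a x, f (a *: x) = a *: f x.
Proof. by move=> lf a x; rewrite -[a *: x]addr0 lf lin_0 // addr0. Qed.

Lemma lin_sum U V (f : U -> V) : lin f -> forall I (s : seq I) F,
  f (\sum_(i <- s) F i) = \sum_(i <- s) f (F i).
Proof.
move=> lf I s F; elim: s => [|i s IHs]; first by rewrite !big_nil lin_0.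
by rewrite !big_cons lin_D // IHs.
Qed.

Lemma tensor_rel_sum U V W (f : V -> W -> U) s t :
  (forall w, lin (f^~ w)) -> (forall v, lin (f v)) -> tensor_rel s t ->
  \sum_(p <- s) f p.1 p.2 = \sum_(p <- t) f p.1 p.2.
Proof.
move=> fl fr; elim=> {s t} //=.
- by move=> s t u _ -> _ ->.
- by move=> s s' t t' _ ss' _ tt'; rewrite !big_cat /= ss' tt'.
- by move=> s t; rewrite !big_cat /= addrC.
- by move=> w; rewrite big_seq1 big_nil (lin_0 (fl w)).
- by move=> v v' w; rewrite !big_cons !big_nil !addr0 (lin_D (fl w)).
- by move=> v w w'; rewrite !big_cons !big_nil !addr0 (lin_D (fr v)).
- by move=> a v w; rewrite !big_seq1 /= (lin_Z (fl w)) (lin_Z (fr v)).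
Qed.

Lemma tlift_pure U V W (f : V -> W -> U) v w :
  (forall w, lin (f^~ w)) -> (forall v, lin (f v)) ->
  tlift f (v ⊗ w) = f v w.
Proof.
move=> fl fr; rewrite /tlift.
by rewrite (tensor_rel_sum fl fr (tensor_repr [:: (v, w)])) big_seq1.
Qed.

Lemma tensor_ind V W (P : V ⊗ W -> Prop) :
  P 0 -> (forall v w x, P x -> P (v ⊗ w + x)) -> forall x, P x.
Proof.
move=> P0 PD x; rewrite [x]tensor_sum.
elim: (repr x) => [|p s IHs]; first by rewrite big_nil.
by rewrite big_cons; apply: PD.
Qed.

Lemma tlift_lin U V W (f : V -> W -> U) :
  (forall w, lin (f^~ w)) -> (forall v, lin (f v)) -> lin (tlift f).
Proof.
move=> fl fr a x y; rewrite /tlift.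
rewrite (tensor_rel_sum fl fr (tensor_repr _)) big_cat /=.
rewrite (tensor_rel_sum fl fr (tensor_repr _)) big_map scaler_sumr.
congr (_ + _); apply: eq_bigr => p _; exact: (lin_Z (fl p.2)).
Qed.

Lemma eq_tlift U V W (f g : V -> W -> U) x :
  (forall v w, f v w = g v w) -> tlift f x = tlift g x.
Proof. by move=> fg; apply: eq_bigr. Qed.

Lemma lin_tlift U U' V W (L : U -> U') (f : V -> W -> U) x : lin L ->
  L (tlift f x) = tlift (fun v w => L (f v w)) x.
Proof. by move=> lL; rewrite /tlift (lin_sum lL). Qed.

Lemma exchange_tlift U V W V' W' (f : V -> W -> V' -> W' -> U) x y :
  \ten_(a, b <- x) \ten_(c, d <- y) f a b c d =
  \ten_(c, d <- y) \ten_(a, b <- x) f a b c d.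
Proof. exact: exchange_big. Qed.

Lemma tensor_lin_ext U V W (f g : V ⊗ W -> U) : lin f -> lin g ->
  (forall v w, f (v ⊗ w) = g (v ⊗ w)) -> forall x, f x = g x.
Proof.
move=> lf lg fg; apply: tensor_ind => [|v w x IHx]; first by rewrite !lin_0.
by rewrite !lin_D // fg IHx.
Qed.

Lemma lin_id U : lin (fun x : U => x). Proof. by []. Qed.

Lemma lin_linear U V W (f : {linear V -> W}) (g : U -> V) :
  lin g -> lin (fun x => f (g x)).
Proof. by move=> lg a x y; rewrite lg linearP. Qed.

Lemma lin_comp U V W (f : V -> W) (g : U -> V) :
  lin f -> lin g -> lin (fun x => f (g x)).
Proof. by move=> lf lg a x y; rewrite lg lf. Qed.

Lemma lin_pure_l U V W (w : W) (g : U -> V) : lin g -> lin (fun x => g x ⊗ w).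
Proof. by move=> lg a x y; rewrite lg pureDl pureZl. Qed.

Lemma lin_pure_r U V W (v : V) (g : U -> W) : lin g -> lin (fun x => v ⊗ g x).
Proof. by move=> lg a x y; rewrite lg pureDr pureZr. Qed.

Lemma lin_scale_r U V b (g : U -> V) : lin g -> lin (fun x => b *: g x).
Proof. by move=> lg a x y; rewrite lg scalerDr !scalerA mulrC. Qed.

Lemma lin_scale_l U V (v : V) (g : U -> k^o) :
  lin g -> lin (fun x => (g x : k) *: v).
Proof. by move=> lg a x y; rewrite lg scalerDl -scalerA. Qed.

Lemma lin_tlift_r U V W X (f : X -> V -> W -> U) t :
  (forall v w, lin (fun x => f x v w)) -> lin (fun x => tlift (f x) t).
Proof.
move=> lf a x y; rewrite /tlift scaler_sumr -big_split /=.
by apply: eq_bigr => p _; apply: lf.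
Qed.

Lemma lin_tlift_l U V W X (f : V -> W -> U) (g : X -> V ⊗ W) : lin g ->
  (forall w, lin (f^~ w)) -> (forall v, lin (f v)) ->
  lin (fun x => tlift f (g x)).
Proof. by move=> lg fl fr a x y; rewrite lg tlift_lin. Qed.

End Lin.

(* Associative unital k-algebras.  Unlike the library's algType, this structure
   includes the zero algebra; it inherits the ring notations and theory through
   the pzRingType instance below. *)
HB.mixin Record Lmodule_isPzAlgebra (k : fieldType) A of GRing.Lmodule k A := {
  pzmul : A -> A -> A;
  pzone : A;
  pzmulA : associative pzmul;
  pzmul1l : left_id pzone pzmul;
  pzmul1r : right_id pzone pzmul;
  pzmulDl : left_distributive pzmul +%R;
  pzmulDr : right_distributive pzmul +%R;
  pzscaleAl : forall (a : k) (x y : A), a *: pzmul x y = pzmul (a *: x) y;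
  pzscaleAr : forall (a : k) (x y : A), a *: pzmul x y = pzmul x (a *: y)
}.
#[short(type="pzAlgType")]
HB.structure Definition PzAlgebra (k : fieldType) :=
  {A of GRing.Lmodule k A & Lmodule_isPzAlgebra k A}.

Section PzAlgRing.
Variables (k : fieldType) (A : pzAlgType k).

HB.instance Definition _ := GRing.Zmodule_isPzRing.Build (PzAlgebra.sort A)
  pzmulA pzmul1l pzmul1r pzmulDl pzmulDr.

Lemma pz_scalerAl (a : k) (x y : A) : a *: (x * y) = (a *: x) * y.
Proof. exact: pzscaleAl. Qed.

Lemma pz_scalerAr (a : k) (x y : A) : a *: (x * y) = x * (a *: y).
Proof. exact: pzscaleAr. Qed.

End PzAlgRing.

Section RegularPzAlg.
Variable k : fieldType.

Fact regular_scalerAr (a : k) (x y : k^o) : a *: (x * y) = x * (a *: y).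
Proof. exact: mulrCA. Qed.

HB.instance Definition _ := Lmodule_isPzAlgebra.Build k k^o
  (@mulrA k) (@mul1r k) (@mulr1 k) (@mulrDl k) (@mulrDr k)
  (@mulrA k) regular_scalerAr.

End RegularPzAlg.

HB.mixin Record isCoalgebra (k : fieldType) C of GRing.Lmodule k C := {
  comul : {linear C -> @tensor k C C};
  counit : {linear C -> k^o};
  comulA : forall c : C,
    \ten_(c1, c2 <- comul c) \ten_(x, y <- comul c1) (x ⊗ (y ⊗ c2)) =
    \ten_(c1, c2 <- comul c) \ten_(x, y <- comul c2) (c1 ⊗ (x ⊗ y));
  counitl : forall c : C, \ten_(c1, c2 <- comul c) ((counit c1 : k) *: c2) = c;
  counitr : forall c : C, \ten_(c1, c2 <- comul c) ((counit c2 : k) *: c1) = c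
}.
#[short(type="coalgType")]
HB.structure Definition Coalgebra (k : fieldType) :=
  {C of GRing.Lmodule k C & isCoalgebra k C}.

(* Sweedler notation: \sw_(h1, ..., hn <- h) E is what is usually written E,
   with subscripts 1, ..., n for the iterated comultiplication of h. *)
Notation "\sw_ ( h1 , h2 <- h ) E" := (\ten_(h1, h2 <- comul h) E)
  (at level 41, E at level 41, h1 binder, h2 binder, h at level 50,
   format "'[' \sw_ ( h1 ,  h2  <-  h ) '/  '  E ']'") : ring_scope.

Definition sweedler3 (k : fieldType) (C : coalgType k) (U : lmodType k)
    (f : C -> C -> C -> U) (h : C) : U :=
  \sw_(c, h3 <- h) \sw_(h1, h2 <- c) f h1 h2 h3.

Definition sweedler4 (k : fieldType) (C : coalgType k) (U : lmodType k)
    (f : C -> C -> C -> C -> U) (h : C) : U :=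
  \sw_(c, h4 <- h) sweedler3 (fun h1 h2 h3 => f h1 h2 h3 h4) c.

Notation "\sw_ ( h1 , h2 , h3 <- h ) E" := (sweedler3 (fun h1 h2 h3 => E) h)
  (at level 41, E at level 41, h1 binder, h2 binder, h3 binder, h at level 50,
   format "'[' \sw_ ( h1 ,  h2 ,  h3  <-  h ) '/  '  E ']'") : ring_scope.
Notation "\sw_ ( h1 , h2 , h3 , h4 <- h ) E" :=
  (sweedler4 (fun h1 h2 h3 h4 => E) h)
  (at level 41, E at level 41, h1 binder, h2 binder, h3 binder, h4 binder,
   h at level 50,
   format "'[' \sw_ ( h1 ,  h2 ,  h3 ,  h4  <-  h ) '/  '  E ']'") : ring_scope.

Lemma lin_mul_l (k : fieldType) (U : lmodType k) (A : pzAlgType k) (y : A)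
  (g : U -> A) : lin g -> lin (fun x => g x * y).
Proof. by move=> lg a x z; rewrite lg mulrDl pz_scalerAl. Qed.

Lemma lin_mul_r (k : fieldType) (U : lmodType k) (A : pzAlgType k) (y : A)
  (g : U -> A) : lin g -> lin (fun x => y * g x).
Proof. by move=> lg a x z; rewrite lg mulrDr pz_scalerAr. Qed.

Lemma lin_rmul_l (k : fieldType) (U : lmodType k) (y : k)
  (g : U -> k^o) : lin g -> lin (fun x => (g x * y : k^o)).
Proof. by move=> lg a x z; rewrite lg; apply: etrans (mulrDl _ _ _) _; congr (_ + _); rewrite -mulrA. Qed.

Lemma lin_rmul_r (k : fieldType) (U : lmodType k) (y : k)
  (g : U -> k^o) : lin g -> lin (fun x => (y * g x : k^o)).
Proof. by move=> lg a x z; rewrite lg; apply: etrans (mulrDr _ _ _) _; congr (_ + _); rewrite mulrCA. Qed.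

Ltac lin_step :=
  cbv beta;
  match goal with
  | |- forall _, _ => intro
  | H : lin ?f |- lin ?f => exact H
  | H : lin ?f |- lin (fun x => ?f (@?g x)) => apply (@lin_comp _ _ _ _ f g H)
  | |- lin (fun x => x) => apply lin_id
  | |- lin (GRing.Linear.sort ?f) => exact (fun a x y => linearP f a x y)
  | |- lin (fun x => GRing.Linear.sort ?f (@?g x)) => apply (@lin_linear _ _ _ _ f g)
  | |- lin (fun x => pure (@?g x) ?w) => apply (@lin_pure_l _ _ _ _ w g)
  | |- lin (fun x => pure ?v (@?g x)) => apply (@lin_pure_r _ _ _ _ v g)
  | |- lin (fun x => @GRing.scale _ _ ?b (@?g x)) => apply (@lin_scale_r _ _ _ b g)
  | |- lin (fun x => @GRing.scale _ _ (@?g x) ?v) => apply (@lin_scale_l _ _ _ v g)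
  | |- lin (fun x => tlift (fun a b => @?F x a b) ?t) =>
      apply (@lin_tlift_r _ _ _ _ _ F t)
  | |- lin (fun x => tlift ?f (@?g x)) => apply (@lin_tlift_l _ _ _ _ _ f g)
  | |- lin (tlift ?f) => apply tlift_lin
  | |- lin (fun x => GRing.mul (@?g x) ?y) =>
      first [apply (@lin_mul_l _ _ _ y g) | apply (@lin_rmul_l _ _ y g)]
  | |- lin (fun x => GRing.mul ?y (@?g x)) =>
      first [apply (@lin_mul_r _ _ _ y g) | apply (@lin_rmul_r _ _ y g)]
  end.
Ltac lin_auto := repeat lin_step.

Section CoalgTheory.
Variables (k : fieldType) (C : coalgType k) (U : lmodType k).

Lemma coassoc (F : C -> C -> C -> U) c :
  (forall y z, lin (fun x => F x y z)) -> (forall x z, lin (fun y => F x y z)) ->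
  (forall x y, lin (F x y)) ->
  \sw_(c1, c2 <- c) \sw_(x, y <- c1) F x y c2 =
  \sw_(c1, c2 <- c) \sw_(x, y <- c2) F c1 x y.
Proof.
move=> F1 F2 F3.
pose L (t : (C ⊗ (C ⊗ C))%type) := \ten_(x, w <- t) \ten_(y, z <- w) F x y z.
have lL : lin L by rewrite /L; lin_auto.
have LE x y z : L (x ⊗ (y ⊗ z)) = F x y z.
  by rewrite /L tlift_pure; lin_auto => //; rewrite tlift_pure.
have /(congr1 L) := comulA c; rewrite !(lin_tlift _ _ lL).
under eq_tlift => c1 c2 do rewrite (lin_tlift _ _ lL).
under [X in _ = X -> _]eq_tlift => c1 c2 do rewrite (lin_tlift _ _ lL).
move=> H; etransitivity; [|etransitivity; [exact: H|]];
  by do 2!apply: eq_tlift => ? ?; rewrite LE.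
Qed.

Lemma counitlE (F : C -> U) c : lin F ->
  \sw_(c1, c2 <- c) ((counit c1 : k) *: F c2) = F c.
Proof.
move=> lF; rewrite -[in RHS](counitl c) (lin_tlift _ _ lF).
by apply: eq_tlift => x y; rewrite (lin_Z lF).
Qed.

Lemma counitrE (F : C -> U) c : lin F ->
  \sw_(c1, c2 <- c) ((counit c2 : k) *: F c1) = F c.
Proof.
move=> lF; rewrite -[in RHS](counitr c) (lin_tlift _ _ lF).
by apply: eq_tlift => x y; rewrite (lin_Z lF).
Qed.

End CoalgTheory.

Section TensorCoalg.
Variables (k : fieldType) (C D : coalgType k).

Definition tensor_comul (t : C ⊗ D) : (C ⊗ D) ⊗ (C ⊗ D) :=
  \ten_(c, d <- t) \sw_(c1, c2 <- c) \sw_(d1, d2 <- d) ((c1 ⊗ d1) ⊗ (c2 ⊗ d2)).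

Definition tensor_counit (t : C ⊗ D) : k^o :=
  \ten_(c, d <- t) (counit c * counit d : k^o).

Fact tensor_comul_lin : linear tensor_comul.
Proof. by change (lin tensor_comul); rewrite /tensor_comul; lin_auto. Qed.

Fact tensor_counit_lin : linear tensor_counit.
Proof. by change (lin tensor_counit); rewrite /tensor_counit; lin_auto. Qed.

HB.instance Definition _ := GRing.isLinear.Build k _ _ _ _ tensor_comul_lin.
HB.instance Definition _ := GRing.isLinear.Build k _ _ _ _ tensor_counit_lin.

Lemma tensor_comul_pure c d : tensor_comul (c ⊗ d) =
  \sw_(c1, c2 <- c) \sw_(d1, d2 <- d) ((c1 ⊗ d1) ⊗ (c2 ⊗ d2)).
Proof. by rewrite /tensor_comul tlift_pure; lin_auto. Qed.

Lemma tensor_counit_pure c d : tensor_counit (c ⊗ d) = counit c * counit d.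
Proof. by rewrite /tensor_counit tlift_pure; lin_auto. Qed.

Lemma tlift_tensor_comul (U : lmodType k) (F : C ⊗ D -> C ⊗ D -> U) c d :
  (forall y, lin (F^~ y)) -> (forall x, lin (F x)) ->
  tlift F (tensor_comul (c ⊗ d)) =
  \sw_(c1, c2 <- c) \sw_(d1, d2 <- d) F (c1 ⊗ d1) (c2 ⊗ d2).
Proof.
move=> Fl Fr; have lF : lin (tlift F) by apply: tlift_lin.
rewrite tensor_comul_pure (lin_tlift _ _ lF); apply: eq_tlift => c1 c2.
by rewrite (lin_tlift _ _ lF); apply: eq_tlift => d1 d2; rewrite tlift_pure.
Qed.

Fact tensor_comulA t :
  \ten_(t1, t2 <- tensor_comul t) \ten_(x, y <- tensor_comul t1) (x ⊗ (y ⊗ t2)) =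
  \ten_(t1, t2 <- tensor_comul t) \ten_(x, y <- tensor_comul t2) (t1 ⊗ (x ⊗ y)).
Proof.
have lc : lin tensor_comul := tensor_comul_lin.
have le : lin tensor_counit := tensor_counit_lin.
move: t; apply: tensor_lin_ext => [||c d]; try by lin_auto.
rewrite !tlift_tensor_comul; try by lin_auto.
under eq_tlift => c1 c2 do
  (under eq_tlift => d1 d2 do (rewrite tlift_tensor_comul; [|by lin_auto..]);
   rewrite exchange_tlift).
rewrite [RHS](_ : _ = \sw_(c1, c2 <- c) \sw_(c3, c4 <- c2) \sw_(d1, d2 <- d)
   \sw_(d3, d4 <- d2) (c1 ⊗ d1) ⊗ ((c3 ⊗ d3) ⊗ (c4 ⊗ d4))); last first.
  apply: eq_tlift => c1 c2; rewrite [RHS]exchange_tlift; apply: eq_tlift => d1 d2.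
  by rewrite tlift_tensor_comul //; lin_auto.
rewrite coassoc; try by lin_auto.
do 2!apply: eq_tlift => ? ?.
by rewrite coassoc //; lin_auto.
Qed.

Fact tensor_counitl t :
  \ten_(t1, t2 <- tensor_comul t) ((tensor_counit t1 : k) *: t2) = t.
Proof.
have lc : lin tensor_comul := tensor_comul_lin.
have le : lin tensor_counit := tensor_counit_lin.
move: t; apply: tensor_lin_ext => [||c d]; try by lin_auto.
rewrite tlift_tensor_comul; try by lin_auto.
under eq_tlift => c1 c2 do under eq_tlift => d1 d2 do
  rewrite tensor_counit_pure -scalerA -pureZr.
under eq_tlift => c1 c2 do rewrite -(lin_tlift _ _ (lin_scale_r _ (@lin_id _ _))).
under eq_tlift => c1 c2 do
  (rewrite -(lin_tlift _ _ (lin_pure_r _ (@lin_id _ _))) counitl -pureZl).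
by rewrite -(lin_tlift _ _ (lin_pure_l _ (@lin_id _ _))) counitl.
Qed.

Fact tensor_counitr t :
  \ten_(t1, t2 <- tensor_comul t) ((tensor_counit t2 : k) *: t1) = t.
Proof.
have lc : lin tensor_comul := tensor_comul_lin.
have le : lin tensor_counit := tensor_counit_lin.
move: t; apply: tensor_lin_ext => [||c d]; try by lin_auto.
rewrite tlift_tensor_comul; try by lin_auto.
under eq_tlift => c1 c2 do under eq_tlift => d1 d2 do
  rewrite tensor_counit_pure -scalerA -pureZr.
under eq_tlift => c1 c2 do rewrite -(lin_tlift _ _ (lin_scale_r _ (@lin_id _ _))).
under eq_tlift => c1 c2 do
  (rewrite -(lin_tlift _ _ (lin_pure_r _ (@lin_id _ _))) counitr -pureZl).
by rewrite -(lin_tlift _ _ (lin_pure_l _ (@lin_id _ _))) counitr.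
Qed.

HB.instance Definition _ := isCoalgebra.Build k (C ⊗ D)%type
  tensor_comulA tensor_counitl tensor_counitr.

End TensorCoalg.

Section RegularCoalg.
Variable k : fieldType.

Definition regular_comul (a : k^o) : k^o ⊗ k^o := (a : k) *: ((1 : k^o) ⊗ (1 : k^o)).

Fact regular_comul_lin : linear regular_comul.
Proof. by move=> a x y; rewrite /regular_comul scalerDl -scalerA. Qed.

HB.instance Definition _ := GRing.isLinear.Build k _ _ _ _ regular_comul_lin.

Lemma tlift_regular_comul (U : lmodType k) (F : k^o -> k^o -> U) a :
  (forall y, lin (F^~ y)) -> (forall x, lin (F x)) ->
  tlift F (regular_comul a) = a *: F 1 1.
Proof.
move=> Fl Fr; have lF := tlift_lin Fl Fr.
by rewrite (lin_Z lF) tlift_pure.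
Qed.

Fact regular_comulA a :
  \ten_(t1, t2 <- regular_comul a) \ten_(x, y <- regular_comul t1) (x ⊗ (y ⊗ t2)) =
  \ten_(t1, t2 <- regular_comul a) \ten_(x, y <- regular_comul t2) (t1 ⊗ (x ⊗ y)).
Proof.
have lr : lin regular_comul := regular_comul_lin.
by rewrite !tlift_regular_comul; lin_auto.
Qed.

Definition regular_counit : {linear k^o -> k^o} := idfun.

Fact regular_counitl a :
  \ten_(x, y <- regular_comul a) ((regular_counit x : k) *: y) = a.
Proof.
rewrite tlift_regular_comul; [by rewrite /= scale1r; apply: mulr1|by lin_auto..].
Qed.

Fact regular_counitr a :
  \ten_(x, y <- regular_comul a) ((regular_counit y : k) *: x) = a.
Proof.
rewrite tlift_regular_comul; [by rewrite /= scale1r; apply: mulr1|by lin_auto..].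
Qed.

HB.instance Definition _ := isCoalgebra.Build k (k^o)%type
  regular_comulA regular_counitl regular_counitr.

End RegularCoalg.

Definition coalg_morphism (k : fieldType) (C D : coalgType k) (f : C -> D) :=
  (forall c, comul (f c) = \sw_(c1, c2 <- c) (f c1 ⊗ f c2)) /\
  (forall c, counit (f c) = counit c).

Section Convolution.
Variables (k : fieldType) (C : coalgType k) (A : pzAlgType k).

Definition conv (f g : C -> A) (c : C) : A := \sw_(c1, c2 <- c) (f c1 * g c2).

Definition conv1 (c : C) : A := (counit c : k) *: (1 : A).

Definition conv_inverse (f g : C -> A) : Prop :=
  (forall c, conv f g c = conv1 c) /\ (forall c, conv g f c = conv1 c).

Definition conv_invertible (f : {linear C -> A}) : Prop :=
  exists g : {linear C -> A}, conv_inverse f g.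

(* As with the library's x^-1, the value at a non-invertible f is f. *)
Definition conv_inv (f : {linear C -> A}) : {linear C -> A} :=
  if pselect (conv_invertible f) is left ex then projT1 (cid ex) else f.

Lemma conv_invP (f : {linear C -> A}) :
  conv_invertible f -> conv_inverse f (conv_inv f).
Proof. by rewrite /conv_inv; case: pselect => // ex _; case: (cid ex). Qed.

End Convolution.

HB.mixin Record isCoquasiBialgebra (k : fieldType) H of Coalgebra k H := {
  qmul : {linear @tensor k H H -> H};
  qunit : {linear k^o -> H};
  omega : {linear @tensor k (@tensor k H H) H -> k^o};
  qmul_coalg : coalg_morphism qmul;
  qunit_coalg : coalg_morphism qunit;
  omega_invertible : conv_invertible omega;
  qmulA : forall h g l : H,
    \sw_(h1, h2 <- h) \sw_(g1, g2 <- g) \sw_(l1, l2 <- l)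
      (omega (h2 ⊗ g2 ⊗ l2) : k) *: qmul (h1 ⊗ qmul (g1 ⊗ l1)) =
    \sw_(h1, h2 <- h) \sw_(g1, g2 <- g) \sw_(l1, l2 <- l)
      (omega (h1 ⊗ g1 ⊗ l1) : k) *: qmul (qmul (h2 ⊗ g2) ⊗ l2);
  qmul1l : forall h : H, qmul (qunit 1 ⊗ h) = h;
  qmul1r : forall h : H, qmul (h ⊗ qunit 1) = h;
  omega_cocycle : forall h g l n : H,
    \sw_(h1, h2 <- h) \sw_(g1, g2 <- g) \sw_(l1, l2 <- l) \sw_(n1, n2 <- n)
      (omega (h1 ⊗ g1 ⊗ qmul (l1 ⊗ n1)) * omega (qmul (h2 ⊗ g2) ⊗ l2 ⊗ n2)) =
    \sw_(h1, h2 <- h) \sw_(g1, g2, g3 <- g) \sw_(l1, l2, l3 <- l)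
      \sw_(n1, n2 <- n)
      (omega (g1 ⊗ l1 ⊗ n1) * omega (h1 ⊗ qmul (g2 ⊗ l2) ⊗ n2) *
       omega (h2 ⊗ g3 ⊗ l3));
  omega_unit : forall h g : H,
    omega (h ⊗ qunit 1 ⊗ g) = (counit h * counit g : k^o)
}.
#[short(type="coquasiBialgType")]
HB.structure Definition CoquasiBialgebra (k : fieldType) :=
  {H of Coalgebra k H & isCoquasiBialgebra k H}.

Notation "h ∙ g" := (qmul (h ⊗ g)) (at level 39, left associativity) : ring_scope.

Section CrossedSystem.
Variables (k : fieldType) (H : coquasiBialgType k) (R : pzAlgType k).

Definition hone : H := qunit 1.

Record crossed_system := CrossedSystem {
  xact : {linear (H ⊗ R)%type -> R};
  xcoc : {linear (H ⊗ H)%type -> R};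
  xactM : forall (h : H) (r s : R),
    xact (h ⊗ (r * s)) = \sw_(h1, h2 <- h) (xact (h1 ⊗ r) * xact (h2 ⊗ s));
  xactr1 : forall h : H, xact (h ⊗ (1 : R)) = (counit h : k) *: (1 : R);
  xact1h : forall r : R, xact (hone ⊗ r) = r;
  xact_xact : forall (h g : H) (r : R),
    \sw_(h1, h2 <- h) \sw_(g1, g2 <- g)
      (xact (h1 ⊗ xact (g1 ⊗ r)) * xcoc (h2 ⊗ g2)) =
    \sw_(h1, h2 <- h) \sw_(g1, g2 <- g)
      (xcoc (h1 ⊗ g1) * xact (h2 ∙ g2 ⊗ r));
  xcoch1 : forall h : H, xcoc (h ⊗ hone) = (counit h : k) *: (1 : R);
  xcoc1h : forall h : H, xcoc (hone ⊗ h) = (counit h : k) *: (1 : R);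
  xact_xcoc : forall h g l : H,
    \sw_(h1, h2 <- h) \sw_(g1, g2 <- g) \sw_(l1, l2 <- l)
      (xact (h1 ⊗ xcoc (g1 ⊗ l1)) * xcoc (h2 ⊗ (g2 ∙ l2))) =
    \sw_(h1, h2, h3 <- h) \sw_(g1, g2, g3 <- g) \sw_(l1, l2 <- l)
      (conv_inv omega (h3 ⊗ g3 ⊗ l2) : k) *:
        (xcoc (h1 ⊗ g1) * xcoc (h2 ∙ g2 ⊗ l1))
}.

(* The operations of a right H-comodule algebra.  The axioms are not recorded:
   isomorphisms of H-comodule algebras only involve the operations. *)
Record comodalg_ops := ComodalgOps {
  ca_carrier :> lmodType k;
  ca_mul : {linear (ca_carrier ⊗ ca_carrier)%type -> ca_carrier};
  ca_one : ca_carrier;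
  ca_coact : {linear ca_carrier -> (ca_carrier ⊗ H)%type}
}.

Definition algebra_iso (A B : comodalg_ops) (f : {linear A -> B}) : Prop :=
  [/\ bijective f,
      forall x y, f (ca_mul A (x ⊗ y)) = ca_mul B (f x ⊗ f y) &
      f (ca_one A) = ca_one B].

Definition colinear (A B : comodalg_ops) (f : {linear A -> B}) : Prop :=
  forall x, ca_coact B (f x) = \ten_(x0, x1 <- ca_coact A x) (f x0 ⊗ x1).

Definition comodalg_iso (A B : comodalg_ops) (f : {linear A -> B}) : Prop :=
  algebra_iso f /\ colinear f.

Section CrossedProduct.
Variable S : crossed_system.

Definition xmul (t : (R ⊗ H) ⊗ (R ⊗ H)) : R ⊗ H :=
  \ten_(x, y <- t) \ten_(r, h <- x) \ten_(s, g <- y)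
    \sw_(h1, h2, h3 <- h) \sw_(g1, g2 <- g)
      ((r : R) * xact S (h1 ⊗ s) * xcoc S (h2 ⊗ g1)) ⊗ (h3 ∙ g2).

Definition xcoact (t : R ⊗ H) : (R ⊗ H) ⊗ H :=
  \ten_(r, h <- t) \sw_(h1, h2 <- h) ((r ⊗ h1) ⊗ h2).

Fact xmul_linear : linear xmul.
Proof. by change (lin xmul); rewrite /xmul /sweedler3; lin_auto. Qed.
HB.instance Definition _ := GRing.isLinear.Build k _ _ _ xmul xmul_linear.

Fact xcoact_linear : linear xcoact.
Proof. by change (lin xcoact); rewrite /xcoact; lin_auto. Qed.
HB.instance Definition _ := GRing.isLinear.Build k _ _ _ xcoact xcoact_linear.

Definition crossed_product : comodalg_ops :=
  @ComodalgOps (R ⊗ H)%type xmul ((1 : R) ⊗ hone) xcoact.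

Lemma xmul_pure (r s : R) (h g : H) :
  xmul ((r ⊗ h) ⊗ (s ⊗ g)) =
  \sw_(h1, h2, h3 <- h) \sw_(g1, g2 <- g)
      (r * xact S (h1 ⊗ s) * xcoc S (h2 ⊗ g1)) ⊗ (h3 ∙ g2).
Proof. by rewrite /xmul /sweedler3 !tlift_pure; lin_auto. Qed.

Lemma xcoact_pure (r : R) (h : H) :
  xcoact (r ⊗ h) = \sw_(h1, h2 <- h) ((r ⊗ h1) ⊗ h2).
Proof. by rewrite /xcoact tlift_pure; lin_auto. Qed.

End CrossedProduct.

(* The left R-action on R ⊗ H by multiplication on the first factor. *)
Definition lact (r : R) (x : R ⊗ H) : R ⊗ H := \ten_(s, h <- x) ((r * s) ⊗ h).

Lemma lact_pure (r s : R) (h : H) : lact r (s ⊗ h) = (r * s) ⊗ h.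
Proof. by rewrite /lact tlift_pure; lin_auto. Qed.

Definition left_linear (S1 S2 : crossed_system)
    (f : {linear crossed_product S1 -> crossed_product S2}) : Prop :=
  forall r x, f (lact r x) = lact r (f x).

End CrossedSystem.

Arguments hone {k H}.

Notation "h '·[' S ] r" := (xact S (h ⊗ r))
  (at level 39, S at level 0, format "h  ·[ S ]  r") : ring_scope.
Notation "σ[ S ]( h , g )" := (xcoc S (h ⊗ g))
  (at level 0, S at level 0, h at level 99, g at level 99,
   format "σ[ S ]( h ,  g )") : ring_scope.

(* Main.v *)
Require Import Defs.
From mathcomp Require Import all_boot all_algebra.
From HB Require Import structures.
From mathcomp Require Import boolp.

Set Implicit Arguments.
Unset Strict Implicit.
Unset Printing Implicit Defensive.

Import GRing.Theory.
Local Open Scope ring_scope.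

(** The whole argument takes place in convolution algebras.  Write [*] for the
    convolution product, both on linear maps H -> R and on linear maps
    H ⊗ H -> R.  A linear map f : H -> R gives two maps on H ⊗ H:
    [lext f], which is f ⊗ ε, and [act S f], which sends h ⊗ x to h · f(x).  Both
    assignments are unital algebra morphisms ([lext_conv], [act_conv]; the
    second one because H measures R), so they preserve convolution inverses.

    For a linear map f on a coalgebra C and a coalgebra map φ : C -> H, let
    [fork f φ] be (f ⊗ φ)Δ : C -> R ⊗ H; applying ε to the second factor recovers
    f.  The structures of the theorem act on such maps by convolution alone:
    - the product of fork f id at h and fork g id at x in the crossed product
      is fork (lext f * act S g * σ) m at h ⊗ x, for m the multiplication of H
      ([xmul_fork]);
    - the map θ_a of the theorem satisfies θ_a ∘ fork f φ = fork (f * (a ∘ φ)) φ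
      ([theta_fork]).

    The left linear, right colinear maps are exactly the θ_a, where a(h) is
    obtained by applying ε to θ(1 ⊗ h) ([left_linear_colinearE]); composing them
    amounts to convolving, so θ_a is invertible exactly when a is.  Moreover θ_a
    is multiplicative exactly when, for all f and f',
      lext f * act S1 f' * σ1 * (a ∘ m) = lext (f * a) * act S2 (f' * a) * σ2
    ([theta_xmulP]).

    Clearing inverses, condition (2) reads a * (- ·2 r) = (- ·1 r) * a
    ([intertwines]), which propagates to lext a * act S2 f = act S1 f * lext a
    ([intertwines_act]); and condition (3) reads
    σ1 * (a ∘ m) = act S1 a * lext a * σ2 ([cohomologous]).  Given these two
    identities the multiplicativity identity is a computation with associative
    products.  Conversely, evaluating it at h ⊗ 1 gives the first identity, and
    f = f' = ε then gives the second ([theta_multiplicativeP]).  Unitality of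
    θ_a means a(1) = 1; it comes with (3), which at 1 ⊗ 1 says that the
    invertible element a(1) is idempotent ([cohomologous_hone]). *)

(** * Linear maps on tensors and iterated comultiplications *)

(** Scalars that are values of a k^o-valued map, such as counits, have to be
    read in k for the lemma on scalings to unify; lin_tac adds this case. *)
Ltac lin_scale_step :=
  cbv beta;
  match goal with
  | |- @lin ?k ?U ?V (fun x => @GRing.scale _ _ ?b (@?g x)) =>
      refine (@lin_scale_r k U V b g _)
  end.
Ltac lin_tac := repeat first [lin_step | lin_scale_step].

Section Multilinear.
Variable k : fieldType.

Lemma linear_inverse (U V : lmodType k) (f : {linear U -> V}) :
  bijective f -> exists g : {linear V -> U}, cancel f g /\ cancel g f.
Proof.
case=> g fK gK.
pose gL := GRing.isLinear.Build k V U _ g (can2_linear fK gK).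
by exists (HB.pack_for {linear V -> U} g gL).
Qed.

(** Moves between the two bracketings of a fourfold comultiplication that
    arise when a factor is split off on the left or on the right. *)
Lemma coassoc4 (C : coalgType k) (U : lmodType k)
    (F : C -> C -> C -> C -> U) c :
  (forall c2 c3 c4, lin (fun x => F x c2 c3 c4)) ->
  (forall c1 c3 c4, lin (fun x => F c1 x c3 c4)) ->
  (forall c1 c2 c4, lin (fun x => F c1 c2 x c4)) ->
  (forall c1 c2 c3, lin (F c1 c2 c3)) ->
  \sw_(c1, x <- c) \sw_(c2, c3, c4 <- x) F c1 c2 c3 c4 =
  \sw_(c1, c2, c3, c4 <- c) F c1 c2 c3 c4.
Proof.
move=> F1 F2 F3 F4; rewrite /sweedler4 /sweedler3.
rewrite -(coassoc (F := fun c1 x c4 => \sw_(c2, c3 <- x) F c1 c2 c3 c4));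
  try by lin_tac.
by apply: eq_tlift => x c4; rewrite coassoc //; lin_tac.
Qed.

Lemma sw_morph (C D : coalgType k) (φ : {linear C -> D}) (U : lmodType k)
    (F : D -> D -> U) c :
  (forall c, comul (φ c) = \sw_(c1, c2 <- c) (φ c1 ⊗ φ c2)) ->
  (forall y, lin (F^~ y)) -> (forall x, lin (F x)) ->
  \sw_(d1, d2 <- φ c) F d1 d2 = \sw_(c1, c2 <- c) F (φ c1) (φ c2).
Proof.
move=> φc Fl Fr; rewrite φc (lin_tlift _ _ (tlift_lin Fl Fr)).
by apply: eq_tlift => c1 c2; rewrite tlift_pure.
Qed.

End Multilinear.

(** * Convolution as multiplication *)

Section ConvolutionAlgebra.
Variables (k : fieldType) (C : coalgType k) (A : pzAlgType k).
Implicit Types f g : {linear C -> A}.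

Fact conv_linear f g : linear (conv f g).
Proof. by change (lin (conv f g)); rewrite /conv; lin_tac. Qed.
HB.instance Definition _ f g := GRing.isLinear.Build k C A _ (conv f g) (conv_linear f g).

Fact conv1_linear : linear (@conv1 k C A).
Proof. by change (lin (@conv1 k C A)); rewrite /conv1; lin_tac. Qed.
HB.instance Definition _ :=
  GRing.isLinear.Build k C A _ (@conv1 k C A) conv1_linear.

Lemma tlift_mulr (V W : lmodType k) (F : V -> W -> A) t (y : A) :
  tlift F t * y = \ten_(v, w <- t) (F v w * y).
Proof. exact: (lin_tlift F t (lin_mul_l y (@lin_id _ A))). Qed.

Lemma tlift_mull (V W : lmodType k) (F : V -> W -> A) t (y : A) :
  y * tlift F t = \ten_(v, w <- t) (y * F v w).
Proof. exact: (lin_tlift F t (lin_mul_r y (@lin_id _ A))). Qed.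

Lemma convA f g (h : {linear C -> A}) : conv (conv f g) h = conv f (conv g h).
Proof.
apply/funext => c; rewrite /conv.
under eq_tlift => c1 c2 do rewrite tlift_mulr.
rewrite coassoc; try by lin_tac.
apply: eq_tlift => c1 c2; rewrite tlift_mull.
by apply: eq_tlift => ? ?; rewrite mulrA.
Qed.

Lemma conv1l f : conv (@conv1 k C A) f = f.
Proof.
apply/funext => c; rewrite -[RHS] (counitlE c (F := f)); last by lin_tac.
by apply: eq_tlift => c1 c2; rewrite /conv1 -pz_scalerAl mul1r.
Qed.

Lemma conv1r f : conv f (@conv1 k C A) = f.
Proof.
apply/funext => c; rewrite -[RHS] (counitrE c (F := f)); last by lin_tac.
by apply: eq_tlift => c1 c2; rewrite /conv1 -pz_scalerAr mulr1.
Qed.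

(** Left-nested convolutions unfold to the left-bracketed iterated
    comultiplication of Sweedler notation; hence the next lemma and [sw43_conv]
    turn the right-hand sides of (2) and (3) into products. *)
Lemma sw3_conv f g (h : {linear C -> A}) c :
  \sw_(c1, c2, c3 <- c) f c1 * g c2 * h c3 = conv (conv f g) h c.
Proof. by apply: eq_tlift => ? ?; rewrite /conv tlift_mulr. Qed.

Lemma conv_inverseP (f g : C -> A) : conv_inverse f g <->
  conv f g = @conv1 k C A /\ conv g f = @conv1 k C A.
Proof.
split=> [[fg gf]|[fg gf]]; first by split; apply/funext.
by split=> c; rewrite ?fg ?gf.
Qed.

(** Solves for s'; with l, p the maps [lext a], [act S1 a] and m = a ∘ m_H this
    exchanges the inverse-free form of (3) with (3) itself. *)
Lemma conv_unwind (l l' p p' s s' m : {linear C -> A}) :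
  conv_inverse l l' -> conv_inverse p p' ->
  conv s m = conv (conv p l) s' <-> s' = conv (conv (conv l' p') s) m :> (C -> A).
Proof.
move=> /conv_inverseP[ll l'l] /conv_inverseP[pp p'p]; split=> [E|->].
  by rewrite !convA /= E convA /= -(convA p') p'p conv1l -convA l'l conv1l.
by rewrite !convA /= !convA /= -(convA l) ll conv1l -convA pp conv1l.
Qed.

(** The maps r ε, through which elements of A become elements of the
    convolution algebra. *)
Definition cst (r : A) (c : C) : A := (counit c : k) *: r.

Fact cst_linear r : linear (cst r).
Proof. by change (lin (cst r)); rewrite /cst; lin_tac. Qed.
HB.instance Definition _ r := GRing.isLinear.Build k C A _ (cst r) (cst_linear r).

Lemma conv_cstl r f c : conv (cst r) f c = r * f c.
Proof.
rewrite /conv -[RHS] (counitlE c (F := fun x => r * f x)); last by lin_tac.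
by apply: eq_tlift => c1 c2; rewrite /cst -pz_scalerAl.
Qed.

End ConvolutionAlgebra.

(** * Convolution on a tensor product of coalgebras *)

Section TensorConv.
Variables (k : fieldType) (C D : coalgType k) (A : pzAlgType k).

Lemma sw_pure (U : lmodType k) (F : C ⊗ D -> C ⊗ D -> U) c d :
  (forall y, lin (F^~ y)) -> (forall x, lin (F x)) ->
  \sw_(t1, t2 <- c ⊗ d) F t1 t2 =
  \sw_(c1, c2 <- c) \sw_(d1, d2 <- d) F (c1 ⊗ d1) (c2 ⊗ d2).
Proof. exact: tlift_tensor_comul. Qed.

Lemma tensor_funext (U : lmodType k) (f g : {linear (C ⊗ D)%type -> U}) :
  (forall c d, f (c ⊗ d) = g (c ⊗ d)) -> f = g :> (_ -> _).
Proof.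
move=> fg; apply/funext.
exact: tensor_lin_ext (fun a => linearP f a) (fun a => linearP g a) fg.
Qed.

Lemma conv_pure (F G : {linear (C ⊗ D)%type -> A}) c d :
  conv F G (c ⊗ d) =
  \sw_(c1, c2 <- c) \sw_(d1, d2 <- d) (F (c1 ⊗ d1) * G (c2 ⊗ d2)).
Proof. by rewrite /conv sw_pure //; lin_tac. Qed.

(** f ⊗ ε: it lets a map in the first variable be convolved with maps in two
    variables. *)
Definition lext (f : C -> A) (t : C ⊗ D) : A :=
  \ten_(c, d <- t) (counit d : k) *: f c.

Fact lext_linear (f : {linear C -> A}) : linear (lext f).
Proof. by change (lin (lext f)); rewrite /lext; lin_tac. Qed.
HB.instance Definition _ (f : {linear C -> A}) :=
  GRing.isLinear.Build k _ A _ (lext f) (lext_linear f).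

Lemma lext_pure (f : {linear C -> A}) c d :
  lext f (c ⊗ d) = (counit d : k) *: f c.
Proof. by rewrite /lext tlift_pure; lin_tac. Qed.

(** The counit in lext f absorbs the second variable, so only the first one
    is comultiplied. *)
Lemma conv_lextl (f : {linear C -> A}) (G : {linear (C ⊗ D)%type -> A}) c d :
  conv (lext f) G (c ⊗ d) = \sw_(c1, c2 <- c) f c1 * G (c2 ⊗ d).
Proof.
rewrite conv_pure; apply: eq_tlift => c1 c2.
rewrite -[RHS] (counitlE d (F := fun d => f c1 * G (c2 ⊗ d))); last by lin_tac.
by apply: eq_tlift => d1 d2; rewrite /= lext_pure -pz_scalerAl.
Qed.

Lemma conv_lextr (f : {linear C -> A}) (G : {linear (C ⊗ D)%type -> A}) c d :
  conv G (lext f) (c ⊗ d) = \sw_(c1, c2 <- c) G (c1 ⊗ d) * f c2.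
Proof.
rewrite conv_pure; apply: eq_tlift => c1 c2.
rewrite -[RHS] (counitrE d (F := fun d => G (c1 ⊗ d) * f c2)); last by lin_tac.
by apply: eq_tlift => d1 d2; rewrite /= lext_pure -pz_scalerAr.
Qed.

Lemma lext_conv (f g : {linear C -> A}) :
  lext (conv f g) = conv (lext f) (lext g).
Proof.
apply: tensor_funext => c d; rewrite /= lext_pure conv_lextl.
rewrite /conv (lin_tlift _ _ (lin_scale_r _ (@lin_id _ _))).
by apply: eq_tlift => c1 c2; rewrite /= lext_pure -pz_scalerAr.
Qed.

Lemma lext_conv1 : lext (@conv1 k C A) = @conv1 k (C ⊗ D)%type A.
Proof.
apply: tensor_funext => c d; rewrite /= lext_pure /conv1 scalerA mulrC.
by congr (_ *: _); apply/esym/tensor_counit_pure.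
Qed.

Lemma lext_inverse (f g : {linear C -> A}) : conv_inverse f g ->
  conv_inverse (lext f) (lext g).
Proof.
case/conv_inverseP=> fg gf; apply/conv_inverseP.
by split; rewrite -lext_conv ?fg ?gf lext_conv1.
Qed.

Lemma sw43_conv (f : {linear C -> A}) (P Q T : {linear (C ⊗ D)%type -> A}) c d :
  \sw_(c1, c2, c3, c4 <- c) \sw_(d1, d2, d3 <- d)
     f c1 * P (c2 ⊗ d1) * Q (c3 ⊗ d2) * T (c4 ⊗ d3) =
  conv (conv (conv (lext f) P) Q) T (c ⊗ d).
Proof.
rewrite conv_pure; apply: eq_tlift => x c4; rewrite /sweedler3.
under eq_tlift => y c3 do rewrite exchange_tlift.
rewrite exchange_tlift; apply: eq_tlift => y d3.
rewrite /= conv_pure tlift_mulr; apply: eq_tlift => z c3.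
rewrite exchange_tlift tlift_mulr; apply: eq_tlift => d1 d2.
by rewrite /= conv_lextl !tlift_mulr.
Qed.

End TensorConv.

(** * Maps into R ⊗ H *)

Section Fork.
Variables (k : fieldType) (C H : coalgType k) (R : pzAlgType k).

(** (f ⊗ φ)Δ.  Elements of R ⊗ H are handled as values of such maps, which turns
    identities in R ⊗ H into identities between the first components f. *)
Definition fork (f : C -> R) (φ : C -> H) (c : C) : R ⊗ H :=
  \sw_(c1, c2 <- c) (f c1 ⊗ φ c2).

Fact fork_linear (f : {linear C -> R}) (φ : {linear C -> H}) : linear (fork f φ).
Proof. by change (lin (fork f φ)); rewrite /fork; lin_tac. Qed.
HB.instance Definition _ (f : {linear C -> R}) (φ : {linear C -> H}) :=
  GRing.isLinear.Build k _ _ _ (fork f φ) (fork_linear f φ).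

Definition counit_r (x : R ⊗ H) : R := \ten_(r, h <- x) ((counit h : k) *: r).

Fact counit_r_linear : linear counit_r.
Proof. by change (lin counit_r); rewrite /counit_r; lin_tac. Qed.
HB.instance Definition _ := GRing.isLinear.Build k _ _ _ counit_r counit_r_linear.

Lemma counit_r_pure r h : counit_r (r ⊗ h) = (counit h : k) *: r.
Proof. by rewrite /counit_r tlift_pure; lin_tac. Qed.

(** A fork along a counital map determines its first component. *)
Lemma counit_r_fork (f : {linear C -> R}) (φ : {linear C -> H}) c :
  (forall c, counit (φ c) = counit c) -> counit_r (fork f φ c) = f c.
Proof.
move=> φe; rewrite /fork (lin_tlift (L := counit_r)); last exact: counit_r_linear.
rewrite -[RHS] (counitrE c (F := f)); last by lin_tac.
by apply: eq_tlift => c1 c2; rewrite counit_r_pure φe.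
Qed.

Lemma fork_cst r (φ : {linear C -> H}) c : fork (cst r) φ c = r ⊗ φ c.
Proof.
rewrite -[RHS] (counitlE c (F := fun c => r ⊗ φ c)); last by lin_tac.
by apply: eq_tlift => c1 c2; rewrite /cst pureZl.
Qed.

End Fork.

(** * Crossed systems and the multiplication of the crossed product *)

Section Hone.
Variables (k : fieldType) (H : coquasiBialgType k).

Lemma comul_hone : comul (hone : H) = hone ⊗ hone.
Proof.
rewrite /hone (qunit_coalg (s := H)).1.
have e := @tlift_regular_comul k _ (fun x y => qunit (s := H) x ⊗ qunit y) 1.
by apply: etrans (e H _ _) (scale1r _); lin_tac.
Qed.

Lemma counit_hone : counit (hone : H) = 1.
Proof. exact: (qunit_coalg (s := H)).2. Qed.

Lemma sw_hone (U : lmodType k) (F : H -> H -> U) :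
  (forall y, lin (F^~ y)) -> (forall x, lin (F x)) ->
  \sw_(h1, h2 <- hone) F h1 h2 = F hone hone.
Proof. by move=> Fl Fr; rewrite comul_hone tlift_pure. Qed.

End Hone.

Section Act.
Variables (k : fieldType) (H : coquasiBialgType k) (R : pzAlgType k).
Variable S : crossed_system H R.
Implicit Types (f g : {linear H -> R}) (r : R).

Definition act (f : H -> R) (t : H ⊗ H) : R := \ten_(h, x <- t) xact S (h ⊗ f x).

Fact act_linear f : linear (act f).
Proof. by change (lin (act f)); rewrite /act; lin_tac. Qed.
HB.instance Definition _ f := GRing.isLinear.Build k _ R _ (act f) (act_linear f).

Lemma act_pure f h x : act f (h ⊗ x) = xact S (h ⊗ f x).
Proof. by rewrite /act tlift_pure; lin_tac. Qed.

(** H measures R, pointwise in the second variable. *)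
Lemma act_conv f g : act (conv f g) = conv (act f) (act g).
Proof.
apply: tensor_funext => h x; rewrite /= conv_pure exchange_tlift.
rewrite /= act_pure /=.
rewrite (lin_tlift (L := fun r => xact S (h ⊗ r))); last by lin_tac.
apply: eq_tlift => x1 x2; rewrite xactM.
by apply: eq_tlift => h1 h2; rewrite !act_pure.
Qed.

Definition act_on r (h : H) : R := xact S (h ⊗ r).

Fact act_on_linear r : linear (act_on r).
Proof. by change (lin (act_on r)); rewrite /act_on; lin_tac. Qed.
HB.instance Definition _ r :=
  GRing.isLinear.Build k H R _ (act_on r) (act_on_linear r).

Lemma act_cst r : act (cst r) = lext (act_on r).
Proof.
apply: tensor_funext => h x; rewrite /= act_pure lext_pure /cst /act_on.
by rewrite pureZr linearZ.
Qed.

Lemma act_conv1 : act (@conv1 k H R) = @conv1 k (H ⊗ H)%type R.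
Proof.
rewrite act_cst -lext_conv1; congr lext.
by apply/funext => h; rewrite /act_on xactr1.
Qed.

Lemma act_inverse (f g : {linear H -> R}) : conv_inverse f g ->
  conv_inverse (act f) (act g).
Proof.
case/conv_inverseP=> fg gf; apply/conv_inverseP.
by split; rewrite -act_conv ?fg ?gf act_conv1.
Qed.

(** Up to coassociativity, the defining formula of the crossed product is a
    threefold convolution on H ⊗ H paired with the multiplication of H.  Taking
    arbitrary maps f and g, and not just r ε and s ε, makes the formula apply to
    images under θ as well. *)
Lemma xmul_fork f g h x :
  xmul S (fork f idfun h ⊗ fork g idfun x) =
  fork (conv (conv (lext f) (act g)) (xcoc S)) qmul (h ⊗ x).
Proof.
have lc : lin (conv (conv (lext f) (act g)) (xcoc S)) by apply: conv_linear.
have lx : lin (xmul S) by apply: xmul_linear.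
rewrite [in RHS]/fork sw_pure; try by lin_tac.
rewrite (lin_tlift (L := fun t => xmul S (t ⊗ fork g idfun x))); last by lin_tac.
transitivity (\sw_(h1, h2 <- h) \sw_(x1, x2 <- x) \sw_(h3, h4, h5 <- h2) \sw_(x3, x4 <- x2)
   (f h1 * xact S (h3 ⊗ g x1) * xcoc S (h4 ⊗ x3)) ⊗ (h5 ∙ x4)).
  apply: eq_tlift => h1 h2.
  rewrite (lin_tlift (L := fun t => xmul S (f h1 ⊗ h2 ⊗ t))); last by lin_tac.
  by apply: eq_tlift => x1 x2; rewrite xmul_pure.
(* Both sides equal the sum over x1, x3, x4 of F; x is split on the right
   in the crossed product and on the left in the convolution. *)
rewrite exchange_tlift [RHS]exchange_tlift.
pose F (x1 x3 x4 : H) := \sw_(h1, h2, h3, h4 <- h)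
   (f h1 * xact S (h2 ⊗ g x1) * xcoc S (h3 ⊗ x3)) ⊗ (h4 ∙ x4).
have F1 x3 x4 : lin (fun x1 => F x1 x3 x4).
  by rewrite /F /sweedler4 /sweedler3; lin_tac.
have F2 x1 x4 : lin (fun x3 => F x1 x3 x4).
  by rewrite /F /sweedler4 /sweedler3; lin_tac.
have F3 x1 x3 : lin (F x1 x3).
  by rewrite /F /sweedler4 /sweedler3; lin_tac.
transitivity (\sw_(x1, y <- x) \sw_(x3, x4 <- y) F x1 x3 x4).
  apply: eq_tlift => x1 y.
  under eq_tlift => h1 h2 do (rewrite /sweedler3;
    under eq_tlift => h3 h4 do rewrite exchange_tlift;
    rewrite exchange_tlift).
  rewrite exchange_tlift; apply: eq_tlift => x3 x4.
  by apply: coassoc4; lin_tac.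
rewrite -coassoc //; apply: eq_tlift => y x4.
rewrite /F /sweedler4 /sweedler3 exchange_tlift; apply: eq_tlift => h' h5.
rewrite /= conv_pure exchange_tlift.
rewrite (lin_tlift (L := fun r => r ⊗ (h5 ∙ x4))); last by lin_tac.
apply: eq_tlift => x1 x3.
rewrite (lin_tlift (L := fun r => r ⊗ (h5 ∙ x4))); last by lin_tac.
apply: eq_tlift => h'' h4; rewrite /= conv_lextl tlift_mulr.
rewrite (lin_tlift (L := fun r => r ⊗ (h5 ∙ x4))); last by lin_tac.
by apply: eq_tlift => h1 h3; rewrite /= act_pure.
Qed.

End Act.

(** * Left linear and right colinear maps *)

Section Theta.
Variables (k : fieldType) (H : coquasiBialgType k) (R : pzAlgType k).
Implicit Types a b f g : {linear H -> R}.

Lemma lact_linear r : linear (@lact k H R r).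
Proof. by change (lin (lact (H := H) r)); rewrite /lact; lin_tac. Qed.

Definition theta (a : H -> R) (x : R ⊗ H) : R ⊗ H :=
  \ten_(r, h <- x) \sw_(h1, h2 <- h) ((r : R) * a h1) ⊗ h2.

Fact theta_linear a : linear (theta a).
Proof. by change (lin (theta a)); rewrite /theta; lin_tac. Qed.
HB.instance Definition _ a :=
  GRing.isLinear.Build k _ _ _ (theta a) (theta_linear a).

Lemma theta_pure a r h : theta a (r ⊗ h) = \sw_(h1, h2 <- h) (r * a h1) ⊗ h2.
Proof. by rewrite /theta tlift_pure; lin_tac. Qed.

(** Coassociativity moves the factor a next to f. *)
Lemma theta_fork (C : coalgType k) (f : {linear C -> R}) (φ : {linear C -> H}) a c :
  (forall c, comul (φ c) = \sw_(c1, c2 <- c) (φ c1 ⊗ φ c2)) ->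
  theta a (fork f φ c) = fork (conv f (a \o φ)) φ c.
Proof.
move=> φc; rewrite (lin_tlift (L := theta a)); last exact: theta_linear.
transitivity (\sw_(c1, c2 <- c) \sw_(x, y <- c2) (f c1 * a (φ x)) ⊗ φ y).
  by apply: eq_tlift => c1 c2; rewrite theta_pure (sw_morph c2 φc) //; lin_tac.
rewrite -coassoc; try by lin_tac.
apply: eq_tlift => x c3.
by rewrite (lin_tlift (L := fun r => r ⊗ φ c3)) //; lin_tac.
Qed.

Lemma theta_fork_id f a h :
  theta a (fork f idfun h) = fork (conv f a) idfun h.
Proof.
by apply: theta_fork => c; apply: tensor_sum.
Qed.

(** Pure tensors r ⊗ h are forks of r ε, so forks span R ⊗ H. *)
Lemma fork_lin_ext (U : lmodType k) (F G : R ⊗ H -> U) : lin F -> lin G ->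
  (forall f h, F (fork f idfun h) = G (fork f idfun h)) -> F =1 G.
Proof.
move=> lF lG FG; apply: tensor_lin_ext => // r h.
by have := FG (cst r) h; rewrite fork_cst.
Qed.

Lemma fork_inj f g : fork f (idfun : H -> H) = fork g idfun ->
  f = g :> (H -> R).
Proof.
move=> fg; apply/funext => h.
by rewrite -(@counit_r_fork _ _ _ _ f idfun h) // fg counit_r_fork.
Qed.

Lemma theta_cancel a b : conv_inverse a b -> cancel (theta a) (theta b).
Proof.
case/conv_inverseP=> ab _ x.
have la : lin (theta a) by apply: theta_linear.
have lb : lin (theta b) by apply: theta_linear.
move: x; apply: fork_lin_ext => [||f h]; try by lin_tac.
by rewrite !theta_fork_id convA ab conv1r.
Qed.

(** Compare first components of θ_b θ_a and the identity on 1 ⊗ h. *)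
Lemma theta_cancel_conv a b : cancel (theta a) (theta b) ->
  conv a b = @conv1 k H R.
Proof.
move=> abK; apply: fork_inj; apply/funext => h.
by rewrite -[RHS] abK theta_fork_id theta_fork_id /= conv1l.
Qed.

Lemma theta_one a : theta a ((1 : R) ⊗ hone) = (1 : R) ⊗ hone <-> a hone = 1.
Proof.
rewrite theta_pure sw_hone; try by lin_tac.
rewrite mul1r; split=> [e|-> //].
have := congr1 (@counit_r k H R) e.
by rewrite !counit_r_pure counit_hone !scale1r.
Qed.

Lemma theta_lact a r x : theta a (lact r x) = lact r (theta a x).
Proof.
have ll : lin (@lact k H R r) by apply: lact_linear.
have lt : lin (theta a) by apply: theta_linear.
move: x; apply: tensor_lin_ext => [||s h]; try by lin_tac.
rewrite lact_pure !theta_pure (lin_tlift _ _ ll); apply: eq_tlift => h1 h2.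
by rewrite lact_pure mulrA.
Qed.

Lemma theta_xcoact a x :
  xcoact (theta a x) = \ten_(x0, x1 <- xcoact x) theta a x0 ⊗ x1.
Proof.
have lc : lin (@xcoact k H R) by apply: xcoact_linear.
have lt : lin (theta a) by apply: theta_linear.
move: x; apply: tensor_lin_ext => [||r h]; try by lin_tac.
rewrite theta_pure xcoact_pure !(lin_tlift (L := @xcoact k H R)) //.
rewrite (lin_tlift (L := tlift (fun x0 x1 => theta a x0 ⊗ x1))); last by lin_tac.
under eq_tlift => h1 h2 do rewrite xcoact_pure.
rewrite -coassoc; try by lin_tac.
apply: eq_tlift => h1 h2; rewrite tlift_pure; try by lin_tac.
by rewrite theta_pure (lin_tlift (L := fun t => t ⊗ h2)) //; lin_tac.
Qed.

(** Counitality of H, applied in the middle factor of R ⊗ H ⊗ H: this is what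
    recovers a colinear map from its composite with I ⊗ ε. *)
Lemma xcoact_counit (x : R ⊗ H) :
  \ten_(x0, x1 <- xcoact x) counit_r x0 ⊗ x1 = x.
Proof.
have lc : lin (@xcoact k H R) by apply: xcoact_linear.
have le : lin (@counit_r k H R) by apply: counit_r_linear.
move: x; apply: tensor_lin_ext => [||r h]; try by lin_tac.
rewrite xcoact_pure (lin_tlift (L := tlift (fun x0 x1 => counit_r x0 ⊗ x1))); last by lin_tac.
rewrite -[RHS] (counitlE h (F := fun h => r ⊗ h)); last by lin_tac.
apply: eq_tlift => h1 h2; rewrite tlift_pure; try by lin_tac.
by rewrite counit_r_pure pureZl.
Qed.

End Theta.

(** * Multiplicativity in terms of convolution *)

Section Cohomologous.
Variables (k : fieldType) (H : coquasiBialgType k) (R : pzAlgType k).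
Variables S1 S2 : crossed_system H R.
Implicit Types a b f : {linear H -> R}.

(** Condition (2) without inverses: multiply it by a on the left. *)
Definition intertwines (a : H -> R) := forall r,
  conv a (act_on S2 r) = conv (act_on S1 r) a.

(** Condition (3) without inverses. *)
Definition cohomologous (a : {linear H -> R}) :=
  conv (xcoc S1) (a \o qmul) =
  conv (conv (act S1 a) (lext a)) (xcoc S2).

Lemma intertwinesP a b : conv_inverse a b -> intertwines a <->
  forall h r, h ·[S2] r = \sw_(h1, h2, h3 <- h) b h1 * (h2 ·[S1] r) * a h3.
Proof.
move=> ab; split=> [E h r|E r].
  rewrite (sw3_conv b (act_on S1 r) a) convA -E.
  case/conv_inverseP: ab => _ ba.
  by rewrite -convA ba conv1l.
have -> : act_on S2 r = conv (conv b (act_on S1 r)) a.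
  by apply/funext => h; rewrite -sw3_conv; apply: E.
by case/conv_inverseP: ab => ab _; rewrite -!convA ab conv1l.
Qed.

(** Both sides at h ⊗ x only involve the element f(x) of R, so this is
    [intertwines] for r = f(x). *)
Lemma intertwines_act a : intertwines a -> forall f,
  conv (lext a) (act S2 f) = conv (act S1 f) (lext a).
Proof.
move=> E f; apply: tensor_funext => h x; rewrite /= conv_lextl conv_lextr.
transitivity (conv a (act_on S2 (f x)) h).
  by apply: eq_tlift => h1 h2; rewrite /= act_pure.
by rewrite E; apply: eq_tlift => h1 h2; rewrite /= act_pure.
Qed.

Lemma cohomologousP a b : conv_inverse a b -> cohomologous a <->
  forall h g,
    σ[S2](h, g) =
      \sw_(h1, h2, h3, h4 <- h) \sw_(g1, g2, g3 <- g)
        b h1 * (h2 ·[S1] b g1) * σ[S1](h3, g2) * a (h4 ∙ g3).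
Proof.
move=> ab; have sumE h g : \sw_(h1, h2, h3, h4 <- h) \sw_(g1, g2, g3 <- g)
    b h1 * (h2 ·[S1] b g1) * σ[S1](h3, g2) * a (h4 ∙ g3) =
    conv (conv (conv (lext b) (act S1 b)) (xcoc S1)) (a \o qmul) (h ⊗ g).
  rewrite -sw43_conv.
  by do 5!apply: eq_tlift => ? ?; rewrite /= act_pure.
have E := conv_unwind (xcoc S1) (xcoc S2) (a \o qmul) (lext_inverse H ab)
  (act_inverse S1 ab).
split=> [/E e h g|e]; first by rewrite sumE e.
by apply/E; apply: tensor_funext => h g; rewrite e sumE.
Qed.

(** The comparison of first components of θ(xy) and θ(x)θ(y), where x and y are
    forks of f and f'. *)
Definition theta_multiplicative (a : {linear H -> R}) := forall f f',
  conv (conv (conv (lext f) (act S1 f')) (xcoc S1)) (a \o qmul) =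
  conv (conv (lext (conv f a)) (act S2 (conv f' a))) (xcoc S2).

(** Both sides are forks along the multiplication of H, which is counital, so
    they agree exactly when their first components do. *)
Lemma theta_xmulP a :
  (forall x y, theta a (xmul S1 (x ⊗ y)) = xmul S2 (theta a x ⊗ theta a y)) <->
  theta_multiplicative a.
Proof.
have key f f' h x : theta a (xmul S1 (fork f idfun h ⊗ fork f' idfun x)) =
  fork (conv (conv (conv (lext f) (act S1 f')) (xcoc S1)) (a \o qmul)) qmul (h ⊗ x).
  by rewrite xmul_fork theta_fork //; case: (qmul_coalg (s := H)).
have key' f f' h x :
  xmul S2 (theta a (fork f idfun h) ⊗ theta a (fork f' idfun x)) =
  fork (conv (conv (lext (conv f a)) (act S2 (conv f' a))) (xcoc S2)) qmul (h ⊗ x).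
  by rewrite !theta_fork_id xmul_fork.
have qe := (qmul_coalg (s := H)).2.
split=> [M f f'|M].
  apply: tensor_funext => h x.
  by rewrite -(counit_r_fork _ _ qe) -key M key' (counit_r_fork _ _ qe).
have lt : lin (theta a) by apply: theta_linear.
have l1 : lin (xmul S1) by apply: xmul_linear.
have l2 : lin (xmul S2) by apply: xmul_linear.
move=> x y; move: x; apply: fork_lin_ext => [||f h]; try by lin_tac.
move: y; apply: fork_lin_ext => [||f' x]; try by lin_tac.
by rewrite key M key'.
Qed.

(** h ↦ h ⊗ 1 is a coalgebra map because 1 is grouplike. *)
Lemma conv_hone (F G : {linear (H ⊗ H)%type -> R}) h :
  conv F G (h ⊗ hone) = \sw_(h1, h2 <- h) F (h1 ⊗ hone) * G (h2 ⊗ hone).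
Proof.
rewrite conv_pure; apply: eq_tlift => h1 h2.
by rewrite sw_hone //; lin_tac.
Qed.

(** Normalization makes the cocycle trivial on H ⊗ 1. *)
Lemma conv_xcoc_hone (S : crossed_system H R) (F : {linear (H ⊗ H)%type -> R}) h :
  conv F (xcoc S) (h ⊗ hone) = F (h ⊗ hone).
Proof.
rewrite conv_hone -[RHS] (counitrE h (F := fun x => F (x ⊗ hone))); last by lin_tac.
by apply: eq_tlift => h1 h2; rewrite xcoch1 -pz_scalerAr mulr1.
Qed.

(** Restricting multiplicativity for f = ε, f' = r ε to H ⊗ 1 removes the
    cocycles and leaves [intertwines]; f = f' = ε leaves [cohomologous] once a
    is moved past act S2 a. *)
Lemma theta_multiplicativeP a : a hone = 1 ->
  theta_multiplicative a <-> intertwines a /\ cohomologous a.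
Proof.
move=> a1; split=> [M|[E1 E2] f f'].
  have E1 : intertwines a.
    move=> r; apply/funext => h.
    have := congr1 (fun F => F (h ⊗ hone)) (M (@conv1 k H R) (cst r)).
    rewrite /= lext_conv1 !conv1l conv_xcoc_hone /= conv_lextl => e.
    transitivity (\sw_(h1, h2 <- h) a h1 * act S2 (conv (cst r) a) (h2 ⊗ hone)).
      by apply: eq_tlift => h1 h2; rewrite act_pure /= conv_cstl a1 mulr1.
    rewrite -e conv_hone; apply: eq_tlift => h1 h2 /=.
    by rewrite conv_xcoc_hone /= act_pure /= qmul1r /cst counit_hone scale1r.
  split=> //; rewrite /cohomologous.
  have := M (@conv1 k H R) (@conv1 k H R).
  by rewrite lext_conv1 act_conv1 !conv1l intertwines_act.
rewrite lext_conv (convA (lext f) (lext a)) /= intertwines_act // act_conv.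
by rewrite !convA /= E2 !convA /= ?convA.
Qed.

(** At 1 ⊗ 1 the relation becomes a(1) = a(1) a(1), and a(1) has inverse b(1). *)
Lemma cohomologous_hone a b : conv_inverse a b -> cohomologous a -> a hone = 1.
Proof.
move=> [_ ba] /(congr1 (fun F => F ((hone : H) ⊗ (hone : H)))).
rewrite conv_xcoc_hone conv_hone sw_hone; try by lin_tac.
rewrite /= qmul1r xcoc1h counit_hone scale1r mul1r conv_hone sw_hone; try by lin_tac.
rewrite /= act_pure xact1h lext_pure counit_hone scale1r => e.
have := ba hone; rewrite /conv sw_hone; try by lin_tac.
rewrite /conv1 counit_hone scale1r => b1.
by rewrite -[LHS] mul1r -b1 -mulrA -e.
Qed.

End Cohomologous.

(** * Isomorphisms of crossed products *)

Section Isomorphisms.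
Variables (k : fieldType) (H : coquasiBialgType k) (R : pzAlgType k).
Implicit Types S : crossed_system H R.

Definition component S1 S2 (θ : {linear crossed_product S1 -> crossed_product S2})
  (h : H) : R := counit_r (θ ((1 : R) ⊗ h) : R ⊗ H).

Fact component_linear S1 S2
  (θ : {linear crossed_product S1 -> crossed_product S2}) : linear (component θ).
Proof.
by move=> a x y; rewrite /component pureDr pureZr linearP [counit_r _]linearP.
Qed.
HB.instance Definition _ S1 S2
    (θ : {linear crossed_product S1 -> crossed_product S2}) :=
  GRing.isLinear.Build k H R _ (component θ) (component_linear θ).

(** Left linearity reduces to x = 1 ⊗ h.  There, colinearity gives
    θ(1 ⊗ h1) ⊗ h2 for the coaction of θ(1 ⊗ h), and collapsing the middle
    factor with ε gives a(h1) ⊗ h2. *)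
Lemma left_linear_colinearE S1 S2
    (θ : {linear crossed_product S1 -> crossed_product S2}) :
  left_linear θ -> colinear θ -> forall x, θ x = theta (component θ) x.
Proof.
move=> θl θc; pose t : R ⊗ H -> R ⊗ H := θ.
have lt : lin t by move=> a x y; apply: linearP.
have tl r x : t (lact r x) = lact r (t x) := θl r x.
have tc x : xcoact (t x) = \ten_(x0, x1 <- xcoact x) t x0 ⊗ x1 := θc x.
have le : lin (@counit_r k H R) by apply: counit_r_linear.
apply: (tensor_lin_ext lt (theta_linear _)) => r h.
have -> : r ⊗ h = lact r ((1 : R) ⊗ h) by rewrite lact_pure mulr1.
rewrite tl theta_lact; congr (lact r _).
rewrite -[LHS] xcoact_counit tc xcoact_pure theta_pure.
rewrite (lin_tlift (L := tlift (fun x0 x1 => t x0 ⊗ x1))); last by lin_tac.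
rewrite (lin_tlift (L := tlift (fun x0 x1 => counit_r x0 ⊗ x1))); last by lin_tac.
apply: eq_tlift => h1 h2.
by rewrite !tlift_pure; try by lin_tac; rewrite mul1r.
Qed.

Lemma left_linear_can S1 S2
    (θ : {linear crossed_product S1 -> crossed_product S2})
    (η : {linear crossed_product S2 -> crossed_product S1}) :
  cancel θ η -> cancel η θ -> left_linear θ -> left_linear η.
Proof. by move=> θK ηK θl r x; rewrite -{1}[x]ηK -θl θK. Qed.

Lemma colinear_can S1 S2
    (θ : {linear crossed_product S1 -> crossed_product S2})
    (η : {linear crossed_product S2 -> crossed_product S1}) :
  cancel θ η -> cancel η θ -> colinear θ -> colinear η.
Proof.
move=> θK ηK θc x; pose t : R ⊗ H -> R ⊗ H := θ; pose u : R ⊗ H -> R ⊗ H := η.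
have lt : lin t by move=> a y z; apply: linearP.
have lu : lin u by move=> a y z; apply: linearP.
have tc y : xcoact (t y) = \ten_(x0, x1 <- xcoact y) t x0 ⊗ x1 := θc y.
have tu y : t (u y) = y := ηK y.
have ut y : u (t y) = y := θK y.
change (xcoact (u x) = \ten_(x0, x1 <- xcoact x) u x0 ⊗ x1).
rewrite -[in RHS] (tu x) tc; move: (xcoact (u x)).
apply: tensor_lin_ext => [||y h]; try by lin_tac.
by rewrite !tlift_pure ?ut //; lin_tac.
Qed.

End Isomorphisms.

Theorem theorem16 (k : fieldType) (H : coquasiBialgType k) (R : pzAlgType k)
    (S1 S2 : crossed_system H R) :
  (forall θ : {linear crossed_product S1 -> crossed_product S2},
     algebra_iso θ -> left_linear θ -> colinear θ ->
     exists a : {linear H -> R},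
       [/\ conv_invertible a,
           forall (r : R) (h : H),
             θ (r ⊗ h) = \sw_(h1, h2 <- h) (r * a h1) ⊗ h2,
           forall (h : H) (r : R),
             h ·[S2] r =
             \sw_(h1, h2, h3 <- h) conv_inv a h1 * (h2 ·[S1] r) * a h3 &
           forall h g : H,
             σ[S2](h, g) =
             \sw_(h1, h2, h3, h4 <- h) \sw_(g1, g2, g3 <- g)
               conv_inv a h1 * (h2 ·[S1] conv_inv a g1) * σ[S1](h3, g2)
                 * a (h4 ∙ g3)]) /\
  (forall a : {linear H -> R},
     conv_invertible a ->
     (forall (h : H) (r : R),
        h ·[S2] r =
        \sw_(h1, h2, h3 <- h) conv_inv a h1 * (h2 ·[S1] r) * a h3) ->
     (forall h g : H,
        σ[S2](h, g) =
        \sw_(h1, h2, h3, h4 <- h) \sw_(g1, g2, g3 <- g)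
          conv_inv a h1 * (h2 ·[S1] conv_inv a g1) * σ[S1](h3, g2)
            * a (h4 ∙ g3)) ->
     exists θ : {linear crossed_product S1 -> crossed_product S2},
       [/\ forall (r : R) (h : H), θ (r ⊗ h) = \sw_(h1, h2 <- h) (r * a h1) ⊗ h2,
           comodalg_iso θ, left_linear θ & colinear θ]).
Proof.
split=> [θ [θbij θM θ1] θl θc|a ainv E1 E2].
  have θE := left_linear_colinearE θl θc.
  have [η [θK ηK]] := linear_inverse θbij.
  have ηE := left_linear_colinearE (left_linear_can θK ηK θl) (colinear_can θK ηK θc).
  (* The inverse of θ is again left linear and colinear, hence of the form
     θ_b, and b is then the convolution inverse of a. *)
  have ainv : conv_inverse (component θ) (component η).
    apply/conv_inverseP; split; apply: theta_cancel_conv => x.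
      by rewrite -θE -ηE θK.
    by rewrite -ηE -θE ηK.
  pose a : {linear H -> R} := component θ.
  have inva : conv_invertible a by exists (component η).
  have a1 : a hone = 1 by apply/theta_one; rewrite -θE; apply: θ1.
  have : theta_multiplicative S1 S2 a.
    by apply/theta_xmulP => x y; rewrite -!θE; apply: θM.
  case/(theta_multiplicativeP _ _ a1) => E1 E2; exists a; split=> //.
  - by move=> r h; rewrite θE theta_pure.
  - exact/(intertwinesP _ _ (conv_invP inva)).
  - exact/(cohomologousP _ _ (conv_invP inva)).
have ab := conv_invP ainv.
have {}E1 : intertwines S1 S2 a by apply/(intertwinesP _ _ ab).
have {}E2 : cohomologous S1 S2 a by apply/(cohomologousP _ _ ab).
have a1 := cohomologous_hone ab E2.
pose θ : {linear crossed_product S1 -> crossed_product S2} :=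
  (theta a : {linear (R ⊗ H)%type -> (R ⊗ H)%type}).
have θc : colinear θ := theta_xcoact a.
exists θ; split=> //; [by move=> r h; apply: theta_pure| |exact: theta_lact].
split=> //; split.
- by exists (theta (conv_inv a)); apply: theta_cancel => //; case: ab.
- by apply/theta_xmulP/(theta_multiplicativeP _ _ a1).
- exact/theta_one.
Qed.
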